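(* For each $n$ let $X=X(n)$ be a balanced random covering variable for an $n$-set $V=V(n)$, with $\mu=\mu(n):=\mathbb{E}|X|>0$, $q_x=\mathbb{P}(x\in X)$ (so $q_x=\mu/n$ for all $x$) and $q_{xy}=\mathbb{P}(x,y\in X)$ (so $q_{xx}=q_x$). Let $T(\mathbf{X})$ be the covering time of the $X$-coupon collector. Asymptotic notation is as $n\to\infty$. (i) If there exists $t=t(n)\ge 0$ such that $\sum_{x,y\in V}(e^{q_{xy}t}-1)=o(n^2)$ and $\sum_{x\in V}e^{-q_xt}=\omega(1)$, then $T(\mathbf{X})\ge t$ whp. (ii) If there exist $\beta=\beta(n)$ with $1<\beta(n)<n$ and $\beta(n)\to\infty$, and $q=q(n)=o\left(\frac{\mu}{n\log\beta}\right)$, such that $q_{xy}\le q$ for all but at most $\frac1\beta n^2$ (''bad'') pairs $(x,y)\in V\times V$, then for every function $w=w(n)\to\infty$, $T(\mathbf{X})\ge\frac n\mu(\log\beta-w)$ whp. In particular, if $q=o\left(\frac{\mu}{n\log n}\right)$ and there are at most $n^{1+o(1)}$ such bad pairs, then $T(\mathbf{X})=(1+ o(1))\frac{n\log n}{\mu}$ whp. (iii) If all coupons have size at most $M=M(n)$ (i.e. $|X|\le M$ with probability $1$), then for every $w=w(n)\to\infty$ (tending to infinity arbitrarily slowly), $T(\mathbf{X})\ge\frac n\mu(\log n-\log M-w)$ whp. In particular, if $M=n^{o(1)}$, then $T(\mathbf{X})=(1+o(1))\frac{n\log n}{\mu}$ whp. (iv) If $q_{xy}=q_{x'y'}$ for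 all $x\ne y$ and $x'\ne y'$ in $V$, all coupons have size at most $M=M(n)$, and $T^-=T^-(n)$ is of the form $T^-=\frac n\mu\cdot\min\big(g(n),\,\log n-w(n)\big)$ with $g(n)=o\left(\frac nM\right)$ and $w(n)\to\infty$, then $T^-\le T(\mathbf{X})$ whp. In particular, if $M=o\left(\frac{n}{\log n}\right)$, then $T(\mathbf{X})=(1+o(1))\frac{n\log n}{\mu}$ whp.
   Context: A random covering variable (random coupon) for a finite set $V$ is a random variable $X$ with values in the power set of $V$. It is balanced if $\mathbb{P}(v\in X)=\mathbb{P}(v'\in X)$ for all $v,v'\in V$. The $X$-coupon collector receives i.i.d. coupons $\mathbf{X}=(X_1,X_2,\dots)$ with $X_i\sim X$; $C_t=\bigcup_{i\le t}X_i$; the covering time is $T=T(\mathbf{X})=\inf\{t\in\mathbb{Z}_{\ge0}:C_t=V\}$ (infinite if there is no such $t$). With high probability (whp) means with probability tending to $1$ as $n\to\infty$. ''$T=(1+o(1))f(n)$ whp'' means $T/f(n)\to1$ in probability. $f=\omega(1)$ means $f(n)\to\infty$. *)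

(* Defs.v *)
From HB Require Import structures.
From mathcomp Require Import all_boot all_order all_algebra.
From mathcomp Require Import all_classical all_reals all_analysis.

Set Implicit Arguments.
Unset Strict Implicit.
Unset Printing Implicit Defensive.

Import Order.TTheory GRing.Theory Num.Theory.
Import numFieldNormedType.Exports.

Local Open Scope classical_set_scope.
Local Open Scope ring_scope.

Section Coupon.
Context {d : measure_display} {Omega : measurableType d} {R : realType}.
Context {V : finType}.
Implicit Types (P : probability Omega R) (X : Omega -> {set V}).

(* Measurability for the discrete sigma-algebra on the power set of [V]. *)
Definition random_covering_variable X :=
  forall B : set {set V}, measurable (X @^-1` B).

Definition incl_prob P X (x : V) : R := fine (P [set w | x \in X w]).

Definition incl_prob2 P X (x y : V) : R :=
  fine (P [set w | (x \in X w) && (y \in X w)]).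

Definition balanced P X := forall v v' : V, incl_prob P X v = incl_prob P X v'.

Definition mean_size P X : R := fine ('E_P[fun w => #|X w|%:R])%E.

Definition size_le P X (M : R) := P [set w | #|X w|%:R <= M] = 1%E.

Definition bad_pairs P X (q : R) : {set V * V} :=
  [set xy : V * V | q < incl_prob2 P X xy.1 xy.2].

Definition mutually_independent P (Xs : nat -> Omega -> {set V}) :=
  forall (s : seq nat) (B : nat -> set {set V}), uniq s ->
    P (\bigcap_(i in [set` s]) (Xs i @^-1` B i)) =
    (\prod_(i <- s) P (Xs i @^-1` B i))%E.

(* Coupons are indexed from 0: [Xs i] is the (i+1)-st coupon. *)
Definition collected (Xs : nat -> Omega -> {set V}) (t : nat) (w : Omega) :
    {set V} :=
  (\bigcup_(i < t) Xs i w)%SET.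

(* Equal to [+oo] when no [t] qualifies, since [ereal_inf set0 = +oo]. *)
Definition covering_time (Xs : nat -> Omega -> {set V}) (w : Omega) : \bar R :=
  ereal_inf [set (t%:R : R)%:E | t in
               [set t : nat | collected Xs t w = [set: V]%SET]].

End Coupon.

(* The coupon [X] and the i.i.d. copies [Xs] may live on different spaces. *)
Record coupon_collector {R : realType} {V : finType}
    {d : measure_display} {Omega : measurableType d}
    {d' : measure_display} {Omega' : measurableType d'}
    (P : probability Omega R) (X : Omega -> {set V})
    (P' : probability Omega' R) (Xs : nat -> Omega' -> {set V}) : Prop := {
  collector_coupon : random_covering_variable X ;
  collector_rv : forall i, random_covering_variable (Xs i) ;
  collector_law : forall i (B : set {set V}),
    P' (Xs i @^-1` B) = P (X @^-1` B) ;
  collector_indep : mutually_independent P' Xs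
}.

Section Whp.
Context {R : realType} {d : nat -> measure_display}.
Context {Omega : forall n, measurableType (d n)}.
Variable P : forall n, probability (Omega n) R.

Definition whp (E : forall n, set (Omega n)) :=
  P n (E n) @[n --> \oo] --> 1%E.

Definition cvg_in_prob (Y : forall n, Omega n -> \bar R) (l : R) :=
  forall e : R, 0 < e ->
    P n [set w | (e%:E < `|Y n w - l%:E|)%E] @[n --> \oo] --> 0%E.

Definition asymp_whp (T : forall n, Omega n -> \bar R) (f : nat -> R) :=
  cvg_in_prob (fun n w => (T n w * ((f n)^-1)%:E)%E) 1.

End Whp.

(* Main.v *)
(** Let [Z] be the number of elements uncovered after [m] coupons. Independence
gives [P(x, y uncovered) = (1 - q_x - q_y + q_xy)^m], and in the balanced case
the second moment method yields, with [q = mu / n],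
  [P(Z = 0) <= n^-2 * \sum_(x, y) (1 + (q_xy - q^2) / (1 - q)^2)^m - 1].
If [\sum_(x, y) (e^(q_xy t) - 1) <= s n^2] then, since the sum of the [q_xy] is
at least [mu^2], one gets [q^2 t <= s]; so replacing [1 - q] by [e^-q] costs only
a factor [e^(O(s))], and [P(T < t) <= 10 s] for every [n].  Each part is then an
upper bound on [s]:
- (ii) good pairs contribute [e^(o(1)) - 1], bad pairs at most
  [beta^-1 * e^(log beta - w)];
- (iii) convexity gives [e^(q_xy t) - 1 <= (q_xy / q) e^(q t)], while
  [\sum q_xy = E|X|^2 <= M mu];
- (iv) the common value of [q_xy] for [x != y] is [O(M q / n)].
The matching upper bounds on [T] are the union bound [E Z <= n e^(-q m)]. *)
Require Import Defs.
From HB Require Import structures.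
From mathcomp Require Import all_boot all_order all_algebra.
From mathcomp Require Import all_classical all_reals all_analysis.
From mathcomp Require Import measurable_realfun ring lra.

Set Implicit Arguments.
Unset Strict Implicit.
Unset Printing Implicit Defensive.

Import Order.TTheory GRing.Theory Num.Theory.
Import numFieldNormedType.Exports.

Local Open Scope classical_set_scope.
Local Open Scope ring_scope.

(** * Laws of random subsets as finite sums *)

Section FiniteLaw.
Context {d : measure_display} {Omega : measurableType d} {R : realType}.
Context {V : finType}.
Implicit Types (P : probability Omega R) (Y : Omega -> {set V}).

(** The power set of [V] is finite, so this mass function turns every probability and moment below
    into a finite sum over [{set V}]. *)
Definition law P Y (A : {set V}) : R := fine (P (Y @^-1` [set A])).

Lemma law_ge0 P Y A : 0 <= law P Y A.
Proof. exact/fine_ge0. Qed.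

Lemma prob_law P Y (b : pred {set V}) : random_covering_variable Y ->
  P [set w | b (Y w)] = (\sum_(A | b A) law P Y A)%:E.
Proof.
move=> mY.
have -> : [set w | b (Y w)] = \bigcup_(A in [set` b]) (Y @^-1` [set A]).
  apply/seteqP; split => w /=; first by move=> bY; exists (Y w).
  by move=> [A /= bA ->].
rewrite measure_fin_bigcup //; last first.
  by move=> A B _ _ [w [/= <- <-]].
rewrite (fsbig_fwiden (enum b)) ?enum_uniq //; first 1 last.
- by move=> A /= bA; rewrite mem_enum.
- by move=> A /= [+ nb]; rewrite mem_enum.
rewrite big_enum /= -sumEFin.
apply: eq_bigr => A _.
by rewrite /law fineK // fin_num_measure //; exact: mY.
Qed.

Lemma fine_prob_law P Y (b : pred {set V}) : random_covering_variable Y ->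
  fine (P [set w | b (Y w)]) = \sum_(A | b A) law P Y A.
Proof. by move=> mY; rewrite prob_law. Qed.

Lemma law_sum1 P Y : random_covering_variable Y -> \sum_A law P Y A = 1.
Proof.
move=> mY; rewrite -(fine_prob_law P (fun=> true)) //.
by have -> : [set w | true] = [set: Omega]; [exact/seteqP | rewrite probability_setT].
Qed.

Lemma incl_prob_law P Y x : random_covering_variable Y ->
  incl_prob P Y x = \sum_(A : {set V} | x \in A) law P Y A.
Proof. exact: (fine_prob_law P (fun A : {set V} => x \in A)). Qed.

Lemma incl_prob2_law P Y x y : random_covering_variable Y ->
  incl_prob2 P Y x y = \sum_(A : {set V} | (x \in A) && (y \in A)) law P Y A.
Proof. exact: (fine_prob_law P (fun A : {set V} => (x \in A) && (y \in A))). Qed.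

(** Double counting. Taking [I] to be [V], then [V * V], gives the first and second moments of
    [#|Y|]. *)
Lemma exchange_law P Y (I : finType) (b : I -> pred {set V}) :
  \sum_i \sum_(A | b i A) law P Y A = \sum_A law P Y A * #|[pred i | b i A]|%:R.
Proof.
rewrite (exchange_big_dep xpredT) //=; apply: eq_bigr => A _.
by rewrite sumr_const mulr_natr.
Qed.

Lemma sum_incl_prob P Y : random_covering_variable Y ->
  \sum_x incl_prob P Y x = \sum_A law P Y A * #|A|%:R.
Proof.
move=> mY; under eq_bigr do rewrite incl_prob_law //.
by rewrite exchange_law.
Qed.

Lemma sum_incl_prob2 P Y : random_covering_variable Y ->
  \sum_x \sum_y incl_prob2 P Y x y = \sum_A law P Y A * #|A|%:R ^+ 2.
Proof.
move=> mY; rewrite pair_big /=.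
under eq_bigr do rewrite incl_prob2_law //.
rewrite exchange_law; apply: eq_bigr => A _; congr (_ * _).
rewrite -natrX -mulnn -cardsX; congr (_%:R); apply: eq_card => -[x y].
by rewrite !inE.
Qed.

(** [#|Y|] is a sum of indicators, so the Lebesgue integral in [mean_size] is evaluated once here
    and finite sums suffice afterwards. *)
Lemma mean_sizeE P Y : random_covering_variable Y ->
  mean_size P Y = \sum_x incl_prob P Y x.
Proof.
move=> mY; rewrite /mean_size unlock.
have mx x : measurable [set w | x \in Y w] by exact: (mY (fun A : {set V} => x \in A)).
rewrite (eq_integral (fun w => (\sum_x (\1_[set w | x \in Y w] w)%:E)%E)); last first.
  move=> w _; rewrite sumEFin /=; congr (_%:E).
  rewrite -sum1_card natr_sum big_mkcond /=.
  apply: eq_bigr => x _; rewrite indicE; case: ifPn => xY.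
    by rewrite mem_set.
  by rewrite memNset //=; exact/negP.
rewrite ge0_integral_sum //; last first.
  move=> x; apply/measurable_EFinP; exact: measurable_indic.
rewrite (eq_bigr (fun x => (incl_prob P Y x)%:E)) ?sumEFin // => x _.
by rewrite integral_indic // setIT /incl_prob fineK // fin_num_measure.
Qed.

Lemma incl_prob2_diag P Y x : incl_prob2 P Y x x = incl_prob P Y x.
Proof. by congr (fine (P _)); apply/funext => w /=; rewrite andbb. Qed.

End FiniteLaw.

(** The right side is the variance of [N], and each atom with [N a = 0] contributes its mass times
    the squared mean. The bound is used for the number of uncovered elements and, through
    nonnegativity of the left side, as [(E N)^2 <= E N^2] for coupon sizes. *)
Lemma second_moment (R : realFieldType) (T : finType) (f N : T -> R) :
  (forall a, 0 <= f a) -> \sum_a f a = 1 ->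
  (\sum_(a | N a == 0) f a) * (\sum_a f a * N a) ^+ 2
    <= \sum_a f a * N a ^+ 2 - (\sum_a f a * N a) ^+ 2.
Proof.
move=> f0 f1; set e := \sum_a f a * N a.
have -> : \sum_a f a * N a ^+ 2 - e ^+ 2 = \sum_a f a * (N a - e) ^+ 2.
  rewrite [RHS](eq_bigr (fun a => f a * N a ^+ 2 - e *+ 2 * (f a * N a) + e ^+ 2 * f a)).
    by rewrite !big_split /= sumrN -!mulr_sumr f1 -/e; ring.
  by move=> a _; ring.
rewrite mulr_suml [leRHS](bigID (fun a => N a == 0)) /=.
rewrite -[leLHS]addr0 lerD //; last first.
  by apply: sumr_ge0 => a _; rewrite mulr_ge0 // sqr_ge0.
by apply: ler_sum => a /eqP ->; rewrite sub0r sqrrN.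
Qed.

(** * The set of elements left uncovered by the first [m] coupons *)

Section Uncovered.
Context {R : realType} {V : finType}.
Context {d : measure_display} {Omega : measurableType d}.
Context {d' : measure_display} {Omega' : measurableType d'}.
Variables (P : probability Omega R) (X : Omega -> {set V}).
Variables (P' : probability Omega' R) (Xs : nat -> Omega' -> {set V}).
Hypothesis collXs : coupon_collector P X P' Xs.

Definition uncovered (m : nat) (w : Omega') : {set V} := (~: collected Xs m w)%SET.

Lemma rv_map2 (F : {set V} -> {set V} -> {set V}) (Y Z : Omega' -> {set V}) :
  random_covering_variable Y -> random_covering_variable Z ->
  random_covering_variable (fun w => F (Y w) (Z w)).
Proof.
move=> mY mZ B.
have -> : (fun w => F (Y w) (Z w)) @^-1` B =
    \bigcup_(A in [set: {set V}]) (Y @^-1` [set A] `&` Z @^-1` (F A @^-1` B)).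
  by apply/seteqP; split => w /=; [exists (Y w) | case=> A _ /= [->]].
apply: fin_bigcup_measurable => [|A _]; first exact: finite_finset.
by apply: measurableI; [exact: mY | exact: mZ].
Qed.

(** With this, the uncovered set can itself be treated as a coupon: the moment identities for
    [incl_prob] and [incl_prob2] apply to it directly. *)
Lemma rv_uncovered m : random_covering_variable (uncovered m).
Proof.
suff mC : random_covering_variable (collected Xs m).
  exact: (rv_map2 (fun A _ => (~: A)%SET) mC mC).
elim: m => [|m IH] B.
  rewrite (_ : collected Xs 0 = cst finset.set0).
    by rewrite preimage_cst; case: ifP => _; [exact: measurableT | exact: measurable0].
  by apply/funext => w; rewrite /collected big_ord0.
rewrite (_ : collected Xs m.+1 = fun w => (collected Xs m w :|: Xs m w)%SET).
  exact: (rv_map2 (fun A A1 => (A :|: A1)%SET) IH (collector_rv collXs m)).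
by apply/funext => w; rewrite /collected big_ord_recr.
Qed.

Lemma in_uncovered m w x :
  (x \in uncovered m w) = [forall i : 'I_m, x \notin Xs i w].
Proof.
rewrite !inE; apply/idP/forallP => [xC i|xX].
  by apply: contra xC => xi; apply/bigcupP; exists i.
by apply/negP => /bigcupP[i _]; apply/negP/xX.
Qed.

(** Independence and equality of laws enter here: the event is an intersection of [m] events, one
    per coupon, of equal probability. *)
Lemma prob_all_coupons (b : pred {set V}) m :
  fine (P' [set w | [forall i : 'I_m, b (Xs i w)]]) =
  fine (P [set w | b (X w)]) ^+ m.
Proof.
have mX := collector_coupon collXs.
have -> : [set w | [forall i : 'I_m, b (Xs i w)]] =
    \bigcap_(i in [set` iota 0 m]) (Xs i @^-1` [set` b]).
  apply/seteqP; split => w /=.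
    move=> /forallP bX i /=; rewrite mem_iota /= add0n => im.
    exact: (bX (Ordinal im)).
  by move=> bX; apply/forallP => i; apply: (bX (val i)); rewrite /= mem_iota /=.
rewrite (collector_indep collXs (fun=> [set` b])) ?iota_uniq //.
rewrite (eq_bigr (fun=> (fine (P [set w | b (X w)]))%:E)); last first.
  by move=> i _; rewrite (collector_law collXs) fineK // fin_num_measure //; exact: (mX [set` b]).
by rewrite prodEFin (_ : iota 0 m = index_iota 0 m) ?prodr_const_nat ?subn0 //= /index_iota subn0.
Qed.

(** Inclusion-exclusion, checked separately on each value [A] of the coupon. *)
Lemma prob_avoid (x y : V) : fine (P [set w | (x \notin X w) && (y \notin X w)]) =
  1 - incl_prob P X x - incl_prob P X y + incl_prob2 P X x y.
Proof.
have mX := collector_coupon collXs.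
rewrite (fine_prob_law P (fun A : {set V} => (x \notin A) && (y \notin A))) //.
rewrite !incl_prob_law // incl_prob2_law // -(law_sum1 P mX).
rewrite [LHS]big_mkcond [X in _ - X - _ + _]big_mkcond [X in _ - _ - X + _]big_mkcond.
rewrite [X in _ - _ - _ + X]big_mkcond /= -!sumrB -big_split /=.
by apply: eq_bigr => A _; case: (x \in A); case: (y \in A) => /=; ring.
Qed.

Lemma incl_prob2_uncovered m x y : incl_prob2 P' (uncovered m) x y =
  (1 - incl_prob P X x - incl_prob P X y + incl_prob2 P X x y) ^+ m.
Proof.
rewrite -prob_avoid -(prob_all_coupons (fun A => (x \notin A) && (y \notin A))).
congr (fine (P' _)); apply/funext => w /=; rewrite !in_uncovered.
congr (is_true _); apply/andP/forallP => [[/forallP xX /forallP yX] i|xyX].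
  by rewrite xX yX.
by split; apply/forallP => i; case/andP: (xyX i).
Qed.

Lemma incl_prob_uncovered m x :
  incl_prob P' (uncovered m) x = (1 - incl_prob P X x) ^+ m.
Proof.
by rewrite -incl_prob2_diag incl_prob2_uncovered incl_prob2_diag subrK.
Qed.

Lemma covered_second_moment m :
  fine (P' [set w | uncovered m w == finset.set0]) *
    (\sum_x (1 - incl_prob P X x) ^+ m) ^+ 2 <=
  \sum_x \sum_y
     (1 - incl_prob P X x - incl_prob P X y + incl_prob2 P X x y) ^+ m
  - (\sum_x (1 - incl_prob P X x) ^+ m) ^+ 2.
Proof.
have mU := @rv_uncovered m.
under [\sum_x (1 - _) ^+ m]eq_bigr do rewrite -incl_prob_uncovered.
under [\sum_x \sum_y _]eq_bigr => x _ do under eq_bigr do rewrite -incl_prob2_uncovered.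
rewrite sum_incl_prob // sum_incl_prob2 //.
rewrite (fine_prob_law P' (fun A => A == finset.set0)) //.
have := @second_moment R _ (law P' (uncovered m)) (fun A => #|A|%:R)
  (law_ge0 P' (uncovered m)) (law_sum1 P' mU).
by under eq_bigl do rewrite pnatr_eq0 cards_eq0.
Qed.

(** Markov's inequality: a nonempty uncovered set has size at least 1. *)
Lemma uncovered_union_bound m :
  fine (P' [set w | uncovered m w != finset.set0]) <=
  \sum_x (1 - incl_prob P X x) ^+ m.
Proof.
have mU := @rv_uncovered m.
under eq_bigr do rewrite -incl_prob_uncovered.
rewrite (fine_prob_law P' (fun A => A != finset.set0)) //.
rewrite sum_incl_prob // big_mkcond; apply: ler_sum => A _ /=.
case: ifPn => [A0|_]; last by rewrite mulr_ge0 ?law_ge0.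
by rewrite ler_peMr ?law_ge0 // ler1n card_gt0.
Qed.

End Uncovered.

(** By [1 + u <= e^u] at [u = q + 2 q^2], it is enough that [(1 - q) (1 + q + 2 q^2) = 1 + q^2 (1 -
    2 q)] is at least 1. *)
Lemma expRN_le_1B (R : realType) (q : R) : 0 <= q <= 2^-1 ->
  expR (- (q + 2 * q ^+ 2)) <= 1 - q.
Proof.
move=> /andP[q0 q2]; rewrite expRN.
have h := expR_ge1Dx (q + 2 * q ^+ 2).
rewrite -div1r ler_pdivrMr ?expR_gt0 //.
apply: le_trans (ler_wpM2l _ h); last by lra.
rewrite -subr_ge0 (_ : _ - _ = q ^+ 2 * (1 - 2 * q)); last by ring.
by rewrite mulr_ge0 ?sqr_ge0 //; lra.
Qed.

(** On this range [e^(4s) <= 1 / (1 - 4s) <= 1 + 8s], and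
    [(1 + 8s) (1 + s) - 1 = 9s + 8s^2 <= 10s]. *)
Lemma expR_second_moment_bound (R : realType) (s : R) : 0 <= s -> s <= 10^-1 ->
  expR (4 * s) * (1 + s) - 1 <= 10 * s.
Proof.
move=> s0 s1.
have h : expR (4 * s) <= 1 + 8 * s.
  have := expR_ge1Dx (- (4 * s)); rewrite expRN => h.
  have E0 : 0 < expR (4 * s) by exact: expR_gt0.
  have : (1 - 4 * s) * expR (4 * s) <= 1.
    by rewrite -ler_pdivlMr // mul1r.
  nra.
have := ler_wpM2r (_ : 0 <= 1 + s) h; nra.
Qed.

(** * Second moment bound for a balanced coupon *)

Section Bounds.
Context {R : realType} {V : finType}.
Context {d : measure_display} {Omega : measurableType d}.
Context {d' : measure_display} {Omega' : measurableType d'}.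
Variables (P : probability Omega R) (X : Omega -> {set V}).
Variables (P' : probability Omega' R) (Xs : nat -> Omega' -> {set V}).
Hypothesis collXs : coupon_collector P X P' Xs.
Hypothesis balX : balanced P X.
Local Notation n := (#|V|%:R : R).
Local Notation mu := (mean_size P X).
Local Notation q := (mu / n).
Local Notation q2 := (incl_prob2 P X).
Local Notation T := (covering_time (R := R) Xs).

Let mX := collector_coupon collXs.

Lemma incl_probE x : incl_prob P X x = q.
Proof.
rewrite mean_sizeE // (eq_bigr (fun=> incl_prob P X x)); last first.
  by move=> y _; exact: balX.
rewrite sumr_const -[X in X / _](mulr_natr _ #|V|) mulfK // pnatr_eq0 -lt0n.
by apply/card_gt0P; exists x.
Qed.

Lemma incl_prob2_ge0 x y : 0 <= q2 x y.
Proof. exact: fine_ge0. Qed.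

Lemma incl_prob2_le x y : q2 x y <= q.
Proof.
rewrite -(incl_probE x) incl_prob2_law // incl_prob_law //.
rewrite [leRHS](bigID (fun A : {set V} => y \in A)) /=.
by rewrite lerDl; apply: sumr_ge0 => A _; exact: law_ge0.
Qed.

Lemma sum_incl_prob2_ge : mu ^+ 2 <= \sum_x \sum_y q2 x y.
Proof.
rewrite -subr_ge0 sum_incl_prob2 // mean_sizeE // sum_incl_prob //.
have := second_moment (fun A : {set V} => #|A|%:R) (law_ge0 P X) (law_sum1 P mX).
by apply: le_trans; rewrite mulr_ge0 ?sqr_ge0 // sumr_ge0 // => A _; exact: law_ge0.
Qed.

Lemma sum_incl_prob2_le (M : R) : size_le P X M ->
  \sum_x \sum_y q2 x y <= M * mu.
Proof.
move=> XM.
rewrite sum_incl_prob2 // mean_sizeE // sum_incl_prob // mulr_sumr.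
apply: ler_sum => A _; rewrite mulrCA.
have [AM|AM] := leP (#|A|%:R : R) M.
  by rewrite ler_wpM2r ?mulr_ge0 ?law_ge0.
(* The atoms of size at most [M] already have total mass 1, so a larger atom has mass 0. *)
suff -> : law P X A = 0 by rewrite !(mul0r, mulr0).
have m1 := fine_prob_law P (fun A : {set V} => #|A|%:R <= M) mX.
have := law_sum1 P mX; rewrite (bigID (fun A : {set V} => #|A|%:R <= M)) /= -m1.
have -> : P [set w | #|X w|%:R <= M] = 1%E := XM.
move=> /(canRL (addKr _)); rewrite /= addNr => /eqP; rewrite psumr_eq0; last first.
  by move=> B _; exact: law_ge0.
by move=> /allP/(_ A); rewrite mem_index_enum -ltNge AM /= => /(_ isT)/eqP.
Qed.

(* The constant 10 makes the bound trivial as soon as [s > 1/10]. *)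
Lemma covered_prob_le m (t s : R) : (0 < #|V|)%N -> 0 <= mu -> m%:R <= t -> 0 <= s ->
  \sum_x \sum_y (expR (q2 x y * t) - 1) <= s * n ^+ 2 ->
  fine (P' [set w | uncovered Xs m w == finset.set0]) <= 10 * s.
Proof.
move=> V0 mu0 mt s0 Ss; set p := fine _.
have n0 : 0 < n by rewrite ltr0n.
have q0 : 0 <= q by rewrite divr_ge0 // ltW.
have t0 : 0 <= t by apply: le_trans mt.
have p1 : p <= 1.
  have mE : measurable [set w | uncovered Xs m w == finset.set0].
    exact: (rv_uncovered collXs m (fun A => A == finset.set0)).
  by rewrite -lee_fin /p fineK ?probability_le1 // fin_num_measure.
have [s1|s1] := ltP 10^-1 s; first by apply: le_trans p1 _; lra.
apply: le_trans (expR_second_moment_bound s0 s1).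
have := covered_second_moment collXs m; rewrite -/p.
under eq_bigr do rewrite incl_probE.
under [\sum_x \sum_y _]eq_bigr => x _ do under eq_bigr do rewrite !incl_probE.
rewrite sumr_const -[_ ^+ m *+ _](mulr_natl _ #|V|); set e := n * _ => pe.
(* The hypothesis bounds [q ^+ 2 * t]; as [t >= 1] when [m > 0], it forces
   [q] to be small unless [m = 0]. *)
have qt : q ^+ 2 * t <= s.
  rewrite -(ler_pM2r (_ : 0 < n ^+ 2)) ?exprn_gt0 //.
  apply: le_trans Ss; rewrite (_ : _ * _ * _ = mu ^+ 2 * t); last first.
    by field; rewrite gt_eqF.
  apply: le_trans (ler_wpM2r t0 sum_incl_prob2_ge) _.
  rewrite mulr_suml; apply: ler_sum => x _; rewrite mulr_suml.
  by apply: ler_sum => y _; rewrite lerBrDl; exact: expR_ge1Dx.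
have sumexp : \sum_x \sum_y expR (q2 x y * t) <= (1 + s) * n ^+ 2.
  move: Ss; under eq_bigr do rewrite sumrB.
  rewrite sumrB lerBlDr; congr (_ <= _).
  under eq_bigr do rewrite sumr_const.
  by rewrite sumr_const mulrDl mul1r addrC expr2 -mulrnA natrM.
(* With no coupon drawn, both second moment terms equal [n^2] and the inequality reads
   [p n^2 <= 0]. *)
have [m0|m0] := posnP m.
  move: pe; rewrite /e m0 expr0 mulr1.
  under eq_bigr do under eq_bigr do rewrite expr0.
  under eq_bigr do rewrite sumr_const.
  rewrite sumr_const -mulrnA natrM -expr2 subrr => pe.
  have : p <= 0 by rewrite -(ler_pM2r (_ : 0 < n ^+ 2)) ?exprn_gt0 // mul0r.
  have : 1 <= expR (4 * s) by rewrite -expR0 ler_expR mulr_ge0.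
  nra.
have m1 : 1 <= m%:R :> R by rewrite ler1n.
have q12 : 0 <= q <= 2^-1.
  rewrite q0 /=; rewrite leNgt; apply/negP => q12.
  have : q ^+ 2 <= 10^-1 by apply: le_trans s1; apply: le_trans qt; rewrite ler_peMr ?sqr_ge0 // (le_trans m1).
  nra.
have q1 : 0 <= 1 - q by lra.
have e0 : 0 < e.
  apply: mulr_gt0; [exact: n0 | apply: exprn_gt0; lra].
rewrite -(ler_pM2r (_ : 0 < e ^+ 2)) ?exprn_gt0 //.
apply: le_trans pe _; rewrite mulrBl mul1r lerB //.
(* Pair by pair: since [e^(-2q) <= (1 - q)^2 e^(4 q^2)], the base is at most
   [(1 - q)^2 e^(4 q^2) e^(q2 x y)]. In the [m]-th power, [q^2 m <= q^2 t <= s] bounds the middle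
   factor by [e^(4s)]. *)
apply: (@le_trans _ _ (\sum_x \sum_y (1 - q) ^+ m ^+ 2 * expR (4 * s) * expR (q2 x y * t))).
  apply: ler_sum => x _; apply: ler_sum => y _.
  (* The base is the probability that one coupon misses both [x] and [y]; its sign is needed for
     monotonicity of the power. *)
  have b0 : 0 <= 1 - q - q + q2 x y.
    by rewrite -{1}(incl_probE x) -(incl_probE y) -(prob_avoid collXs) fine_ge0.
  apply: (@le_trans _ _ (expR (q2 x y - q - q) ^+ m)).
    rewrite lerXn2r ?nnegrE ?expR_ge0 //.
    by apply: le_trans (expR_ge1Dx _); lra.
  apply: (@le_trans _ _ (((1 - q) ^+ 2 * expR (4 * q ^+ 2) * expR (q2 x y)) ^+ m)).
    rewrite lerXn2r ?nnegrE ?expR_ge0 ?mulr_ge0 ?expR_ge0 ?sqr_ge0 //.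
    rewrite -addrA addrC expRD ler_wpM2r ?expR_ge0 //.
    rewrite (_ : - q - q = - (q + 2 * q ^+ 2) + - (q + 2 * q ^+ 2) + 4 * q ^+ 2); last by ring.
    rewrite expRD ler_wpM2r ?expR_ge0 // expRD -expr2.
    by rewrite lerXn2r ?nnegrE ?expR_ge0 ?expRN_le_1B //; lra.
  have q1m : 0 <= (1 - q) ^+ 2 ^+ m by rewrite exprn_ge0 // sqr_ge0.
  rewrite [leLHS]exprMn [X in X * _]exprMn exprAC -!expRM_natr.
  apply: ler_pM; rewrite ?expR_ge0 ?(mulr_ge0 q1m (expR_ge0 _)) //.
    rewrite (ler_wpM2l q1m) // ler_expR -mulrA ler_wpM2l //.
    by apply: le_trans qt; rewrite ler_wpM2l ?sqr_ge0.
  by rewrite ler_expR ler_wpM2l // incl_prob2_ge0.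
under eq_bigr do rewrite -mulr_sumr.
rewrite -mulr_sumr; apply: le_trans (ler_wpM2l _ sumexp) _.
  by rewrite mulr_ge0 ?expR_ge0 ?sqr_ge0.
by rewrite /e le_eqVlt; apply/orP; left; apply/eqP; ring.
Qed.
End Bounds.

(** On [[0, b]] the convex function [e^x] lies below its chord. *)
Lemma expR_chord (R : realType) (a b : R) : 0 <= a <= b -> 0 < b ->
  expR a - 1 <= a / b * (expR b - 1).
Proof.
move=> /andP[a0 ab] b0.
have i1 : 0 <= a / b <= 1 by rewrite ler_pdivrMr // mul1r ab andbT mulr_ge0 ?invr_ge0 ?(ltW b0).
have := convex_expR (Itv01 (andP i1).1 (andP i1).2) (b : R^o) 0.
rewrite !convRE /= /unstable.onem mulr0 addr0 divfK ?gt_eqF // expR0; lra.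
Qed.

(** [k] is the ceiling of [t] minus one, the last integer strictly before [t]; when [t] is an
    integer, the truncation must be lowered by one. *)
Lemma nat_lt_le_succ (R : realType) (t : R) : 0 < t -> exists k, k%:R < t <= k.+1%:R.
Proof.
move=> t0; have /andP[h1 h2] := truncn_itv (ltW t0).
move: h1; rewrite le_eqVlt => /orP[/eqP h1|h1]; last first.
  by exists (Num.truncn t); rewrite h1 ltW.
case E : (Num.truncn t) h1 => [|k] h1; first by move: t0; rewrite -h1 ltxx.
by exists k; rewrite -h1 lexx ltr_nat ltnS leqnn.
Qed.

(** * Tail bounds for the covering time at a fixed [n] *)

Section CoveringTime.
Context {R : realType} {V : finType}.
Context {d : measure_display} {Omega : measurableType d}.
Context {d' : measure_display} {Omega' : measurableType d'}.
Variables (P : probability Omega R) (X : Omega -> {set V}).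
Variables (P' : probability Omega' R) (Xs : nat -> Omega' -> {set V}).
Hypothesis collXs : coupon_collector P X P' Xs.
Hypothesis balX : balanced P X.
Hypothesis V_gt0 : (0 < #|V|)%N.
Hypothesis mu_gt0 : 0 < mean_size P X.
Local Notation n := (#|V|%:R : R).
Local Notation mu := (mean_size P X).
Local Notation q := (mu / n).
Local Notation q2 := (incl_prob2 P X).
Local Notation T := (covering_time (R := R) Xs).

Let mX := collector_coupon collXs.
Let n_gt0 : 0 < n. Proof. by rewrite ltr0n. Qed.
Let q_gt0 : 0 < q. Proof. exact: divr_gt0. Qed.

Lemma uncovered_eq0 m w :
  (uncovered Xs m w == finset.set0) = (collected Xs m w == finset.setT).
Proof. by rewrite -(inj_eq (can_inj (@finset.setCK V))) finset.setCK finset.setC0. Qed.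

Lemma uncovered_anti k m w : (k <= m)%N -> uncovered Xs m w \subset uncovered Xs k w.
Proof.
move=> km; apply/fintype.subsetP => x; rewrite !in_uncovered => /forallP xX.
by apply/forallP => i; exact: (xX (widen_ord km i)).
Qed.

Lemma covering_time_ge (t : R) w :
  (forall m, uncovered Xs m w == finset.set0 -> t <= m%:R) -> (t%:E <= T w)%E.
Proof.
move=> h; apply: le_ereal_inf_tmp => _ [m /= cm <-].
by rewrite lee_fin h // uncovered_eq0 cm.
Qed.

Lemma covering_time_le m w :
  uncovered Xs m w == finset.set0 -> (T w <= (m%:R : R)%:E)%E.
Proof.
rewrite uncovered_eq0 => /eqP cm.
by apply: ereal_inf_lbound; exists m.
Qed.

(** [T] takes integer values or [+oo], and once everything is covered it stays covered, so [T < t]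
    means that [k] coupons suffice. The interval is closed on the right because the inequality on
    [T] is strict. *)
Lemma covering_time_lt k (t : R) : k%:R < t <= k.+1%:R ->
  [set w | (T w < t%:E)%E] = [set w | uncovered Xs k w == finset.set0].
Proof.
move=> /andP[kt tk]; apply/seteqP; split => w /=; last first.
  by move=> /covering_time_le h; apply: le_lt_trans h _; rewrite lte_fin.
apply: contraTT => uk; rewrite -leNgt; apply: covering_time_ge => m um.
apply: le_trans tk _; rewrite ler_nat ltnNge; apply: contra uk => mk.
by rewrite -finset.subset0 -(eqP um) uncovered_anti.
Qed.

Lemma covering_time_lt0 (t : R) : t <= 0 -> [set w | (T w < t%:E)%E] = set0.
Proof.
move=> t0; apply/seteqP; split => w //=; apply/negP; rewrite -leNgt.
by apply: covering_time_ge => m _; apply: le_trans t0 _.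
Qed.

Lemma covering_time_gt k (t : R) : k%:R <= t < k.+1%:R ->
  [set w | (t%:E < T w)%E] = [set w | uncovered Xs k w != finset.set0].
Proof.
move=> /andP[kt tk]; apply/seteqP; split => w /=.
  apply: contraTT; rewrite negbK -leNgt => /covering_time_le h.
  by apply: le_trans h _; rewrite lee_fin.
move=> uk; apply: (@lt_le_trans _ _ (k.+1%:R)%:E); first by rewrite lte_fin.
apply: covering_time_ge => m um.
rewrite ler_nat ltnNge; apply: contra uk => mk.
by rewrite -finset.subset0 -(eqP um) uncovered_anti.
Qed.

Lemma measurable_covering_time_lt (t : R) : measurable [set w | (T w < t%:E)%E].
Proof.
have [t0|/nat_lt_le_succ[k /covering_time_lt ->]] := leP t 0.
  by rewrite covering_time_lt0.
exact: (rv_uncovered collXs k (fun A => A == finset.set0)).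
Qed.

Lemma covering_time_gt_neg (t : R) : t < 0 -> [set w | (t%:E < T w)%E] = setT.
Proof.
move=> t0; apply/seteqP; split => w //= _.
apply: (@lt_le_trans _ _ 0%:E); first by rewrite lte_fin.
by apply: covering_time_ge.
Qed.

Lemma measurable_covering_time_gt (t : R) : measurable [set w | (t%:E < T w)%E].
Proof.
have [t0|/truncn_itv/covering_time_gt ->] := ltP t 0.
  by rewrite covering_time_gt_neg.
exact: (rv_uncovered collXs (Num.truncn t) (fun A => A != finset.set0)).
Qed.

(** The sum is controlled only for [0 <= t]: the thresholds of parts (ii) to (iv) may be negative,
    and then the event is empty. *)
Lemma prob_covering_time_lt (t s : R) : 0 <= s ->
  (0 <= t -> \sum_x \sum_y (expR (q2 x y * t) - 1) <= s * n ^+ 2) ->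
  fine (P' [set w | (T w < t%:E)%E]) <= 10 * s.
Proof.
move=> s0 h; have [t0|t0] := leP t 0.
  by rewrite covering_time_lt0 // measure0 /= mulr_ge0.
have [k /andP[kt tk]] := nat_lt_le_succ t0.
rewrite (@covering_time_lt k) ?kt //.
apply: (covered_prob_le collXs balX V_gt0 _ (ltW kt) s0); first exact: ltW.
exact/h/ltW.
Qed.

(** Union bound after [k = floor t] coupons. The 1 in the exponent pays for rounding:
    [q t <= q (k + 1) <= q k + 1]. *)
Lemma prob_covering_time_gt (t : R) : 0 <= t ->
  fine (P' [set w | (t%:E < T w)%E]) <= n * expR (1 - q * t).
Proof.
move=> t0; have /andP[kt tk] := truncn_itv t0.
rewrite (@covering_time_gt (Num.truncn t)) ?kt //.
set k := Num.truncn t in kt tk *.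
apply: le_trans (uncovered_union_bound collXs k) _.
under eq_bigr do rewrite (incl_probE collXs balX).
rewrite sumr_const -[leLHS](mulr_natl _ #|V|) ler_wpM2l //.
have q1 : 0 <= 1 - q.
  have /card_gt0P[x _] := V_gt0.
  rewrite -(incl_probE collXs balX x) subr_ge0 -(law_sum1 P mX) incl_prob_law //.
  by rewrite [leRHS](bigID (fun A : {set V} => x \in A)) /= lerDl; apply: sumr_ge0 => A _; exact: law_ge0.
apply: (@le_trans _ _ (expR (- q) ^+ k)).
  by rewrite lerXn2r ?nnegrE ?expR_ge0 //; exact: expR_ge1Dx.
rewrite -expRM_natr ler_expR.
have q1' : q <= 1 by rewrite -subr_ge0.
have : q * t <= q * k.+1%:R by rewrite ler_wpM2l ?ltW.
rewrite -natr1; lra.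
Qed.

(** With [q t = L - w], a good pair has exponent at most [delta (L - w) / L <= delta]. The at most
    [e^(-L) n^2] bad pairs contribute at most [e^(L - w)] each, hence [e^(-w) n^2] together. *)
Lemma prob_lt_few_bad_pairs (L w q' delta : R) : 0 < L -> 0 <= w -> 0 <= delta ->
  `|q'| <= delta * (q / L) ->
  #|bad_pairs P X q'|%:R <= expR (- L) * n ^+ 2 ->
  fine (P' [set o | (T o < (q^-1 * (L - w))%:E)%E]) <=
  10 * (expR delta - 1 + expR (- w)).
Proof.
move=> L0 w0 d0 hq' hbad; set t := q^-1 * _.
have ed0 : 0 <= expR delta - 1 by rewrite subr_ge0 -[leLHS]expR0 ler_expR.
apply: prob_covering_time_lt => [|t0]; first by rewrite addr_ge0 ?expR_ge0.
have qt : q * t = L - w by rewrite mulrA divff ?mul1r // gt_eqF.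
have Lw : 0 <= L - w by rewrite -qt mulr_ge0 // ltW.
rewrite pair_big /= (bigID (fun xy => xy \in bad_pairs P X q')) /= addrC mulrDl lerD //.
  apply: (@le_trans _ _ (\sum_(xy | xy \notin bad_pairs P X q') (expR delta - 1))).
    apply: ler_sum => -[x y] /=; rewrite inE /= -leNgt => xy.
    rewrite lerD2r ler_expR.
    apply: (@le_trans _ _ (delta * (q / L) * t)).
      by rewrite ler_wpM2r // (le_trans xy) // (le_trans _ hq') // ler_norm.
    rewrite -mulrA (_ : q / L * t = (q * t) / L); last by ring.
    rewrite qt -[leRHS]mulr1 ler_wpM2l // ler_pdivrMr // mul1r; lra.
  rewrite sumr_const -[leLHS]mulr_natr ler_wpM2l // -natrX -mulnn -card_prod ler_nat.
  exact: max_card.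
apply: (@le_trans _ _ (\sum_(xy in bad_pairs P X q') (expR (L - w)))).
  apply: ler_sum => -[x y] _ /=.
  rewrite lerBlDr -[leLHS]addr0 lerD // ler_expR -qt ler_wpM2r //.
  exact: (incl_prob2_le collXs balX).
rewrite sumr_const -[leLHS]mulr_natr expRD.
apply: le_trans (ler_wpM2l _ hbad) _; first by rewrite mulr_ge0 ?expR_ge0.
by rewrite mulrACA -expRD subrr expR0 mul1r.
Qed.

(** From [mu^2 <= E|X|^2 <= M mu] with [mu > 0]; this makes [ln M] and division by [M]
    meaningful. *)
Lemma size_bound_gt0 (M : R) : size_le P X M -> 0 < M.
Proof.
move=> /(sum_incl_prob2_le collXs) h; rewrite -(pmulr_lgt0 _ mu_gt0).
apply: (lt_le_trans _ h); apply: (lt_le_trans _ (sum_incl_prob2_ge collXs)).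
by rewrite exprn_gt0.
Qed.

(** The chord bound and [E|X|^2 <= M mu] bound the sum by [M n e^(q t)]. The threshold is chosen so
    that [e^(q t) = (n / M) e^(-w)]. *)
Lemma prob_lt_size_le (M w : R) : size_le P X M ->
  fine (P' [set o | (T o < (q^-1 * (ln n - ln M - w))%:E)%E]) <= 10 * expR (- w).
Proof.
move=> XM; have M0 := size_bound_gt0 XM; set t := q^-1 * _.
apply: prob_covering_time_lt => [|t0]; first exact: expR_ge0.
have qt : q * t = ln n - ln M - w by rewrite mulrA divff ?mul1r // gt_eqF.
(* The chord has slope over [q t], so [t = 0] is treated apart; the sum then vanishes. *)
have [->|tN0] := eqVneq t 0.
  under eq_bigr do under eq_bigr do rewrite mulr0 expR0 subrr.
  by rewrite big1 ?mulr_ge0 ?expR_ge0 ?sqr_ge0 // => x _; rewrite big1.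
have t_gt0 : 0 < t by rewrite lt_neqAle eq_sym tN0.
have e0 : 0 <= expR (q * t) - 1.
  by rewrite subr_ge0 -[leLHS]expR0 ler_expR; exact: mulr_ge0 (ltW q_gt0) t0.
apply: (@le_trans _ _ (\sum_x \sum_y q2 x y * (q^-1 * (expR (q * t) - 1)))).
  apply: ler_sum => x _; apply: ler_sum => y _.
  have q2t : 0 <= q2 x y * t <= q * t.
    apply/andP; split; first exact: mulr_ge0 (incl_prob2_ge0 P X x y) t0.
    by rewrite (ler_wpM2r t0) // (incl_prob2_le collXs balX).
  have := expR_chord q2t (mulr_gt0 q_gt0 t_gt0).
  rewrite (_ : q2 x y * t / (q * t) = q2 x y * q^-1); last by rewrite -mulf_div divff ?mulr1.
  by rewrite -mulrA.
under eq_bigr do rewrite -mulr_suml.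
rewrite -mulr_suml.
apply: le_trans (ler_wpM2r _ (sum_incl_prob2_le collXs XM)) _.
  by rewrite mulr_ge0 ?invr_ge0 // ltW.
apply: (@le_trans _ _ (M * n * expR (q * t))).
  rewrite (_ : M * mu * _ = M * n * (expR (q * t) - 1)).
    by rewrite ler_wpM2l ?mulr_ge0 ?ltW // ltrBlDr ltrDl.
  by field; rewrite !gt_eqF.
rewrite qt !expRD expRN !lnK ?posrE // le_eqVlt; apply/orP; left; apply/eqP.
by field; rewrite gt_eqF.
Qed.

(** Each argument of the minimum controls one kind of pair: [g] bounds the off-diagonal exponents by
    [2 delta], while [ln n - w] bounds each of the [n] diagonal terms by [n e^(-w)]. *)
Lemma prob_lt_pairwise_balanced (M g w delta : R) :
  (forall x y x' y' : V, x != y -> x' != y' -> q2 x y = q2 x' y') ->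
  (1 < #|V|)%N -> size_le P X M -> 0 <= delta -> `|g| <= delta * (n / M) ->
  fine (P' [set o | (T o < (q^-1 * Num.min g (ln n - w))%:E)%E]) <=
  10 * (expR (2 * delta) - 1 + expR (- w)).
Proof.
move=> q2E V1 XM d0 hg; have M0 := size_bound_gt0 XM; set t := q^-1 * _.
have ed0 : 0 <= expR (2 * delta) - 1 by rewrite subr_ge0 -[leLHS]expR0 ler_expR mulr_ge0.
apply: prob_covering_time_lt => [|t0]; first by rewrite addr_ge0 ?expR_ge0.
have qt : q * t = Num.min g (ln n - w) by rewrite mulrA divff ?mul1r // gt_eqF.
have qtg : q * t <= g by rewrite qt ge_min lexx.
have qtw : q * t <= ln n - w by rewrite qt ge_min lexx orbT.
have n2 : 2 <= n by rewrite (ler_nat _ 2).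
have c0 : 0 <= 2 * M / n by apply: divr_ge0 (mulr_ge0 _ (ltW M0)) (ltW n_gt0).
(* The [n (n - 1)] equal off-diagonal terms sum to at most [M mu]; the factor 2 comes from
   [n <= 2 (n - 1)]. *)
have off x y : x != y -> q2 x y <= 2 * M / n * q.
  move=> xy; rewrite -(ler_pM2r (_ : 0 < n * (n - 1))); last by rewrite mulr_gt0 //; lra.
  apply: (@le_trans _ _ (M * mu)).
    apply: le_trans (sum_incl_prob2_le collXs XM).
    have -> : q2 x y * (n * (n - 1)) = \sum_(u : V) \sum_(v | v != u) q2 x y.
      under eq_bigr do rewrite sumr_const cardC1 -mulr_natr.
      rewrite sumr_const -[RHS]mulr_natr -(@prednK #|V|) // -natr1 addrK; ring.
    apply: ler_sum => u _; rewrite [leRHS](bigD1 u) //=.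
    apply: le_trans (_ : \sum_(v | v != u) q2 u v <= _).
      by apply: ler_sum => v vu; rewrite (q2E x y u v) // eq_sym.
    by rewrite lerDr incl_prob2_ge0.
  rewrite (_ : 2 * M / n * q * _ = M * mu * (2 * (n - 1) / n)); last first.
    by field; rewrite gt_eqF.
  rewrite -[leLHS]mulr1; apply: ler_wpM2l; first exact: mulr_ge0 (ltW M0) (ltW mu_gt0).
  rewrite ler_pdivlMr //; lra.
apply: (@le_trans _ _ (\sum_(x : V) (n * (expR (2 * delta) - 1) + expR (q * t)))).
  apply: ler_sum => x _; rewrite (bigD1 x) //= addrC lerD //; last first.
    rewrite lerBlDr -[leLHS]addr0 lerD // ler_expR ler_wpM2r //.
    exact: (incl_prob2_le collXs balX).
  apply: (@le_trans _ _ (\sum_(y | y != x) (expR (2 * delta) - 1))).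
    apply: ler_sum => y yx; rewrite lerD2r ler_expR.
    apply: (@le_trans _ _ (2 * M / n * q * t)).
      by rewrite ler_wpM2r // off // eq_sym.
    rewrite -mulrA; apply: (@le_trans _ _ (2 * M / n * g)).
      exact: ler_wpM2l c0 _ _ qtg.
    apply: (@le_trans _ _ (2 * M / n * (delta * (n / M)))).
      exact: ler_wpM2l c0 _ _ (le_trans (ler_norm g) hg).
    by rewrite le_eqVlt; apply/orP; left; apply/eqP; field; rewrite !gt_eqF.
  rewrite sumr_const -[leLHS]mulr_natl ler_wpM2r // ler_nat; exact: max_card.
rewrite sumr_const -[leLHS](mulr_natl _ #|V|); set a := expR (2 * delta) - 1.
rewrite mulrDr [leRHS]mulrDl lerD //; first by rewrite mulrA -expr2 mulrC.
apply: (@le_trans _ _ (n * expR (ln n - w))).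
  by apply: ler_wpM2l (ltW n_gt0) _ _ _; rewrite ler_expR.
by rewrite expRD lnK ?posrE // mulrA -expr2 mulrC.
Qed.

End CoveringTime.

(** * Limits and elementary estimates *)

Lemma cvg_EFin_dist_le (R : realType) (u : nat -> R) (l : R) :
  (forall e, 0 < e -> \forall n \near \oo, `|l - u n| <= e) ->
  (u n)%:E @[n --> \oo] --> l%:E.
Proof.
move=> h; apply/fine_cvgP; split; first exact: nearW.
exact/cvgrPdist_le.
Qed.

Lemma near_ln_ge (R : realType) (A : R) : \forall n \near \oo, A <= ln (n%:R : R).
Proof.
near=> n.
have An : expR A <= n%:R by near: n; exact: nbhs_infty_ger.
rewrite -[leLHS]expRK ler_ln ?posrE ?expR_gt0 //.
exact: lt_le_trans (expR_gt0 _) An.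
Unshelve. all: by end_near. Qed.

Lemma expRN_le (R : realType) (e w : R) : 0 < e -> - ln e <= w -> expR (- w) <= e.
Proof. by move=> e0 ew; rewrite -[leRHS]lnK ?posrE // ler_expR lerNl. Qed.

(** The value [+oo], a collector that never finishes, counts as a deviation through the right
    disjunct. *)
Lemma deviation_lteE (R : realType) (x : \bar R) (f e : R) : (0 <= x)%E -> 0 < f -> 0 < e ->
  (e%:E < `|x * (f^-1)%:E - 1|)%E =
  ((x < ((1 - e) * f)%:E)%E || (((1 + e) * f)%:E < x)%E).
Proof.
move=> x0 f0 e0; case: x x0 => [x x0| _ | //]; last first.
  by rewrite gt0_mulye ?lte_fin ?invr_gt0 //= !ltry ?orbT.
rewrite -EFinM -EFinB -[`|_|%E]/(`|x / f - 1|%:E) !lte_fin.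
rewrite -(ltr_pdivrMr _ x f0) -(ltr_pdivlMr _ x f0) ltr_normr orbC opprB.
by congr (_ || _); [rewrite ltrBrDr -ltrBrDl | rewrite ltrBrDl].
Qed.

(** Explains the later choice [delta = ln (1 + e)]: the term [e^delta - 1] becomes exactly [e]. *)
Lemma expR_lnB1 (R : realType) (e : R) : 0 < e -> expR (ln (1 + e)) - 1 = e.
Proof. by move=> e0; rewrite lnK ?posrE ?addr_gt0 // addrAC subrr add0r. Qed.

(** * From bounds at fixed [n] to statements with high probability *)

Section Asymptotics.
Context {R : realType} {V : nat -> finType}.
Context {d : nat -> measure_display} {Omega : forall n, measurableType (d n)}.
Context {d' : nat -> measure_display} {Omega' : forall n, measurableType (d' n)}.
Variables (P : forall n, probability (Omega n) R) (X : forall n, Omega n -> {set V n}).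
Variables (P' : forall n, probability (Omega' n) R).
Variables (Xs : forall n, nat -> Omega' n -> {set V n}).
Hypothesis cardV : forall n, #|V n| = n.
Hypothesis collXs : forall n, coupon_collector (P n) (@X n) (P' n) (@Xs n).
Hypothesis balX : forall n, balanced (P n) (@X n).
Hypothesis mu_gt0 : forall n, (0 < n)%N -> 0 < mean_size (P n) (@X n).
Local Notation mu n := (mean_size (P n) (@X n)).
Local Notation T := (fun n w => covering_time (R := R) (@Xs n) w).
Local Notation prob_lt n t := (fine (P' n [set w | (T n w < t%:E)%E])).

Lemma whp_covering_time_ge (f : nat -> R) :
  (forall e, 0 < e -> \forall n \near \oo, prob_lt n (f n) <= e) ->
  whp P' (fun n => [set w | ((f n)%:E <= T n w)%E]).
Proof.
move=> h; rewrite /whp.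
have mlt n := measurable_covering_time_lt (collXs n) (f n).
rewrite (_ : (fun n => _) = fun n => (1 - prob_lt n (f n))%:E).
  apply: cvg_EFin_dist_le => e /h; apply: filterS => n.
  by rewrite opprB addrCA subrr addr0 ger0_norm // fine_ge0.
apply/funext => n; rewrite EFinB fineK ?fin_num_measure // -probability_setC //.
congr (P' n _); apply/seteqP; split => w /=; first by move=> h1; apply/negP; rewrite -leNgt.
by move/negP; rewrite -leNgt.
Qed.

Lemma prob_lt_mono n (s t : R) : s <= t -> prob_lt n s <= prob_lt n t.
Proof.
move=> st; have mlt := measurable_covering_time_lt (collXs n).
rewrite fine_le ?fin_num_measure //; apply: le_measure; rewrite ?inE //.
by move=> w /= /lt_le_trans; apply; rewrite lee_fin.
Qed.

(** The upper tail is handled by the union bound for every balanced coupon, so only the lower tail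
    is left as a hypothesis. *)
Lemma asymp_whp_covering_time :
  (forall e, 0 < e < 1 -> forall eps, 0 < eps ->
    \forall n \near \oo, prob_lt n (n%:R / mu n * ((1 - e) * ln n%:R)) <= eps) ->
  asymp_whp P' T (fun n => n%:R * ln n%:R / mu n).
Proof.
pose f (n : nat) : R := n%:R * ln n%:R / mu n.
move=> h e e0; change (P' n [set w | (e%:E < `|T n w * ((f n)^-1)%:E - 1%:E|)%E] @[n --> \oo] --> 0%:E).
have fP n : (1 < n)%N -> 0 < f n.
  move=> n1; rewrite divr_gt0 ?mu_gt0 ?(ltnW n1) // mulr_gt0 ?ltr0n ?(ltnW n1) //.
  by rewrite ln_gt0 // ltr1n.
pose A n := [set w | (T n w < ((1 - e) * f n)%:E)%E].
pose B n := [set w | (((1 + e) * f n)%:E < T n w)%E].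
have mA n : measurable (A n) := measurable_covering_time_lt (collXs n) _.
have mB n : measurable (B n) := measurable_covering_time_gt (collXs n) _.
(* For [n > 1] the normalisation [f n] is positive, as [ln n > 0]; at [n = 1] it is 0. *)
have AB n : (1 < n)%N ->
    [set w | (e%:E < `|T n w * ((f n)^-1)%:E - 1%:E|)%E] = A n `|` B n.
  move=> n1; apply/funext => w /=; rewrite deviation_lteE ?fP //; last first.
    by apply: covering_time_ge.
  by apply/propext; split => [/orP|/orP].
pose p n := fine (P' n [set w | (e%:E < `|T n w * ((f n)^-1)%:E - 1%:E|)%E]).
suff : forall eps, 0 < eps -> \forall n \near \oo, p n <= eps.
  move=> h'; apply: (@cvg_trans _ ((p n)%:E @[n --> \oo])).
    apply: near_eq_cvg; near=> n.
    have n1 : (1 < n)%N by near: n; exact: nbhs_infty_gt.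
    by rewrite /p fineK // fin_num_measure // AB //; exact: measurableU.
  apply: cvg_EFin_dist_le => eps /h'; apply: filterS => n.
  by rewrite sub0r normrN ger0_norm // fine_ge0.
(* The lower tail is assumed small only for deviations below 1; replacing [e] by a smaller [e']
   enlarges that event. *)
move=> eps eps0; pose e' := Num.min e 2^-1.
have e'1 : 0 < e' < 1.
  by rewrite lt_min e0 gt_min invr_gt0 ltr0n /= invf_lt1 ?ltr1n ?orbT.
have e'e : e' <= e by rewrite ge_min lexx.
near=> n.
have n1 : (1 < n)%N by near: n; exact: nbhs_infty_gt.
have n0 : (0 < n)%N by exact: ltnW.
have nR : 0 < n%:R :> R by rewrite ltr0n.
have V0 : (0 < #|V n|)%N by rewrite cardV.
rewrite /p AB //.
apply: (@le_trans _ _ (fine (P' n (A n)) + fine (P' n (B n)))).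
  rewrite -fineD ?fin_num_measure // fine_le ?fin_num_measure //.
  - exact: measurableU.
  - by rewrite fin_numD !fin_num_measure.
  - exact: measureU2.
rewrite [leRHS](splitr eps) lerD //.
  apply: (@le_trans _ _ (prob_lt n (n%:R / mu n * ((1 - e') * ln n%:R)))).
    apply: prob_lt_mono; rewrite (_ : _ * (_ * ln _) = (1 - e') * f n); last by rewrite /f; ring.
    by rewrite ler_wpM2r ?lerB // ltW // fP.
  by near: n; apply: h => //; rewrite divr_gt0.
have ef0 : 0 <= (1 + e) * f n by rewrite mulr_ge0 ?addr_ge0 ?ltW ?fP.
apply: le_trans (prob_covering_time_gt (collXs n) (@balX n) V0 (mu_gt0 n0) ef0) _.
(* Since [q (1 + e) f = (1 + e) ln n], the upper tail bound [n e^(1 - q t)] equals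
   [e^(1 - e ln n)]. *)
rewrite cardV (_ : _ / _ * _ = ln n%:R + e * ln n%:R); last first.
  by rewrite /f; field; rewrite !gt_eqF ?mu_gt0.
rewrite -{1}(@lnK _ n%:R) ?posrE // -expRD.
rewrite (_ : _ + _ = - (e * ln n%:R - 1)); last by ring.
apply: expRN_le; first by rewrite divr_gt0.
rewrite lerBrDr -ler_pdivrMl //.
near: n; exact: near_ln_ge.
Unshelve. all: by end_near. Qed.

End Asymptotics.

(** * Assembly of parts (i) to (iv) *)

Theorem theorem3p3 (R : realType)
  (V : nat -> finType) (cardV : forall n, #|V n| = n)
  (d : nat -> measure_display) (Omega : forall n, measurableType (d n))
  (P : forall n, probability (Omega n) R)
  (X : forall n, Omega n -> {set V n})
  (d' : nat -> measure_display) (Omega' : forall n, measurableType (d' n))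
  (P' : forall n, probability (Omega' n) R)
  (Xs : forall n, nat -> Omega' n -> {set V n})
  (collXs : forall n, coupon_collector (P n) (X n) (P' n) (Xs n))
  (balX : forall n, balanced (P n) (X n))
  (mu_gt0 : forall n, (0 < n)%N -> 0 < mean_size (P n) (X n)) :
  let mu := fun n => mean_size (P n) (X n) in
  let T := fun n (w : Omega' n) => covering_time (R := R) (Xs n) w in
  let T_ge := fun f : nat -> R =>
    whp P' (fun n => [set w | ((f n)%:E <= T n w)%E]) in
  let T_asymp := asymp_whp P' T (fun n => n%:R * ln n%:R / mu n) in
  [/\ (* (i) *)
      forall t : nat -> R,
        (forall n, 0 <= t n) ->
        (fun n => \sum_(x : V n) \sum_(y : V n)
           (expR (incl_prob2 (P n) (X n) x y * t n) - 1))
          =o_\oo (fun n => n%:R ^+ 2 : R) ->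
        \sum_(x : V n) expR (- (incl_prob (P n) (X n) x * t n))
          @[n --> \oo] --> +oo ->
        T_ge t,
      (* (ii) *)
      (forall beta q : nat -> R,
        (forall n, (1 < n)%N -> 1 < beta n < n%:R) ->
        beta n @[n --> \oo] --> +oo ->
        q =o_\oo (fun n => mu n / (n%:R * ln (beta n))) ->
        (forall n, (1 < n)%N ->
          #|bad_pairs (P n) (X n) (q n)|%:R <= (beta n)^-1 * n%:R ^+ 2) ->
        forall w : nat -> R, w n @[n --> \oo] --> +oo ->
          T_ge (fun n => n%:R / mu n * (ln (beta n) - w n)))
      /\
      (forall q : nat -> R,
        q =o_\oo (fun n => mu n / (n%:R * ln n%:R)) ->
        (exists2 e : nat -> R, e n @[n --> \oo] --> (0 : R) &
          \forall n \near \oo,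
            #|bad_pairs (P n) (X n) (q n)|%:R <= n%:R `^ (1 + e n)) ->
        T_asymp),
      (* (iii) *)
      (forall M : nat -> R,
        (forall n, size_le (P n) (X n) (M n)) ->
        forall w : nat -> R, w n @[n --> \oo] --> +oo ->
          T_ge (fun n => n%:R / mu n * (ln n%:R - ln (M n) - w n)))
      /\
      (forall M : nat -> R,
        (forall n, size_le (P n) (X n) (M n)) ->
        (exists2 e : nat -> R, e n @[n --> \oo] --> (0 : R) &
          \forall n \near \oo, M n = n%:R `^ e n) ->
        T_asymp)
      & (* (iv) *)
      (forall n (x y x' y' : V n), x != y -> x' != y' ->
        incl_prob2 (P n) (X n) x y = incl_prob2 (P n) (X n) x' y') ->
      forall M : nat -> R,
        (forall n, size_le (P n) (X n) (M n)) ->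
        (forall g w : nat -> R,
          g =o_\oo (fun n => n%:R / M n) ->
          w n @[n --> \oo] --> +oo ->
          T_ge (fun n => n%:R / mu n * Num.min (g n) (ln n%:R - w n)))
        /\
        (M =o_\oo (fun n => n%:R / ln n%:R) -> T_asymp)].
Proof.
move=> mu T T_ge T_asymp.
have nR n : (0 < n)%N -> 0 < n%:R :> R by rewrite ltr0n.
have V_gt0 n : (0 < n)%N -> (0 < #|V n|)%N by rewrite cardV.
have mu_n n : (mean_size (P n) (@X n) / #|V n|%:R)^-1 = n%:R / mu n.
  by rewrite cardV invf_div.
have near_n1 : \forall n \near \oo, (1 < n)%N by exact: nbhs_infty_gt.
have e20 (e : R) : 0 < e -> 0 < e / 20 by move=> e0; rewrite divr_gt0.
have ln_e20 (e : R) : 0 < e -> 0 < ln (1 + e / 20).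
  by move=> /e20 e0; rewrite ln_gt0 // ltrDl.
have ge := whp_covering_time_ge collXs.
have asymp := asymp_whp_covering_time cardV collXs balX mu_gt0.
split.
- move=> t t0 /eqoP small _; apply: ge => e e0; near=> n.
  have n1 : (1 < n)%N by near: n.
  have n0 := ltnW n1.
  rewrite [leRHS](_ : e = 10 * (e / 10)); last by field.
  apply: (prob_covering_time_lt (collXs n) (@balX n) (V_gt0 _ n0) (mu_gt0 _ n0)).
    by rewrite divr_ge0 // ltW.
  move=> _; rewrite cardV.
  have : `|\sum_(x : V n) \sum_(y : V n) (expR (incl_prob2 (P n) (@X n) x y * t n) - 1)|
      <= e / 10 * `|n%:R ^+ 2 : R|.
    by near: n; apply: small; rewrite divr_gt0.
  rewrite [X in _ <= _ * X]ger0_norm ?sqr_ge0 //.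
  by apply: le_trans; exact: ler_norm.
- split.
  + move=> beta q betaP beta_oo /eqoP small bad w /cvgryPge w_oo.
    apply: ge => e e0; near=> n.
    have n1 : (1 < n)%N by near: n.
    have n0 := ltnW n1.
    have /andP[b1 bn] := betaP _ n1.
    have L0 : 0 < ln (beta n) by rewrite ln_gt0.
    have qn : `|q n| <= ln (1 + e / 20) * `|mu n / (n%:R * ln (beta n))|.
      by near: n; apply: small; exact: ln_e20.
    (* Good pairs and bad pairs each get [e / 20], with [L = ln beta] and
       [delta = ln (1 + e / 20)]. *)
    rewrite [leRHS](_ : e = 10 * (e / 20 + e / 20)); last by field.
    have w0 : 0 <= w n by near: n; exact: w_oo.
    rewrite -mu_n; apply: le_trans.
      apply: (prob_lt_few_bad_pairs (collXs n) (@balX n) (V_gt0 _ n0) (mu_gt0 _ n0)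
        L0 w0 (ltW (ln_e20 _ e0)) (q' := q n)).
      * rewrite cardV; apply: le_trans qn _; rewrite ger0_norm; last first.
          by rewrite divr_ge0 ?mulr_ge0 ?ltW ?nR // mu_gt0.
        by rewrite invfM [mu n * _]mulrA.
      * by rewrite expRN lnK ?posrE ?(lt_trans ltr01) // cardV bad.
    rewrite expR_lnB1 ?e20 // ler_pM2l // lerD2l; apply: expRN_le; first exact: e20.
    by near: n; exact: w_oo.
  + move=> q /eqoP small [r /cvgrPdist_le r0 bad].
    apply: asymp => a /andP[a0 a1] e e0; near=> n.
    have n1 : (1 < n)%N by near: n.
    have n0 := ltnW n1.
    have ln0 : 0 < ln (n%:R : R) by rewrite ln_gt0 // ltr1n.
    have qn : `|q n| <= ln (1 + e / 20) * `|mu n / (n%:R * ln n%:R)|.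
      by near: n; apply: small; exact: ln_e20.
    rewrite [leRHS](_ : e = 10 * (e / 20 + e / 20)); last by field.
    (* Take [L = (1 - a/2) ln n] and [w = (a/2) ln n], so that [L - w = (1 - a) ln n]. Then
       [e^(-L) n^2 = n^(1 + a/2)] exceeds the count [n^(1 + r)] once [|r| <= a/2], and [L <= ln n]
       keeps the assumption on [q] sufficient. *)
    have L0 : 0 < (1 - a / 2) * ln n%:R by rewrite mulr_gt0 //; lra.
    have w0 : 0 <= a / 2 * ln n%:R by rewrite !mulr_ge0 // ltW.
    rewrite (_ : (1 - a) * ln n%:R = (1 - a / 2) * ln n%:R - a / 2 * ln n%:R); last by field.
    rewrite -mu_n; apply: le_trans.
      apply: (prob_lt_few_bad_pairs (collXs n) (@balX n) (V_gt0 _ n0) (mu_gt0 _ n0)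
        L0 w0 (ltW (ln_e20 _ e0)) (q' := q n)).
      * rewrite cardV; apply: le_trans qn _; rewrite ger0_norm; last first.
          by rewrite divr_ge0 ?mulr_ge0 ?ltW ?nR // mu_gt0.
        rewrite invfM [mu n * _]mulrA ler_pM2l ?ln_e20 // ler_pM2l; last first.
          by rewrite divr_gt0 ?nR // mu_gt0.
        by rewrite lef_pV2 ?posrE // ler_piMl ?(ltW ln0) //; lra.
      * have : #|bad_pairs (P n) (@X n) (q n)|%:R <= (n%:R : R) `^ (1 + r n) by near: n.
        move=> /le_trans; apply; rewrite cardV.
        rewrite -[in leRHS](@lnK _ n%:R) ?posrE ?nR // -expRM_natr -expRD.
        rewrite /powR gt_eqF ?nR // ler_expR.
        have : `|0 - r n| <= a / 2 by near: n; apply: r0; rewrite divr_gt0.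
        rewrite sub0r normrN => /(le_trans (ler_norm _)) ra.
        have := ler_wpM2r (ltW ln0) ra; rewrite expRK; lra.
    rewrite expR_lnB1 ?e20 // ler_pM2l // lerD2l; apply: expRN_le; first exact: e20.
    rewrite [leRHS]mulrC -ler_pdivrMr ?divr_gt0 //.
    by near: n; exact: near_ln_ge.
- split.
  + move=> M XM w /cvgryPge w_oo; apply: ge => e e0; near=> n.
    have n1 : (1 < n)%N by near: n.
    have n0 := ltnW n1.
    rewrite -mu_n -[in ln _](cardV n); apply: le_trans.
      exact: (prob_lt_size_le (collXs n) (@balX n) (V_gt0 _ n0) (mu_gt0 _ n0) _ (XM n)).
    rewrite -ler_pdivlMl //; apply: expRN_le; first by rewrite mulr_gt0 // invr_gt0.
    by near: n; exact: w_oo.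
  + move=> M XM [r /cvgrPdist_le r0 Mr]; apply: asymp => a /andP[a0 a1] e e0; near=> n.
    have n1 : (1 < n)%N by near: n.
    have n0 := ltnW n1.
    have ln0 : 0 < ln (n%:R : R) by rewrite ln_gt0 // ltr1n.
    have Mn : M n = n%:R `^ r n by near: n.
    (* As [ln M = r ln n], the slack is [w = (a - r) ln n], which is at least [(a/2) ln n] once
       [|r| <= a/2]. *)
    have -> : (1 - a) * ln n%:R = ln n%:R - ln (M n) - (a - r n) * ln n%:R :> R.
      by rewrite Mn ln_powR; ring.
    rewrite -mu_n -[X in ln X%:R - _ - _](cardV n); apply: le_trans.
      exact: (prob_lt_size_le (collXs n) (@balX n) (V_gt0 _ n0) (mu_gt0 _ n0) _ (XM n)).
    rewrite -ler_pdivlMl //; apply: expRN_le; first by rewrite mulr_gt0 // invr_gt0.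
    apply: (@le_trans _ _ (a / 2 * ln n%:R)).
      rewrite [leRHS]mulrC -ler_pdivrMr ?divr_gt0 //.
      by near: n; exact: near_ln_ge.
    have : `|0 - r n| <= a / 2 by near: n; apply: r0; rewrite divr_gt0.
    rewrite sub0r normrN => /(le_trans (ler_norm _)) ra.
    by rewrite ler_wpM2r ?(ltW ln0) //; lra.
- move=> q2E M XM; split.
  + move=> g w /eqoP small /cvgryPge w_oo; apply: ge => e e0; near=> n.
    have n1 : (1 < n)%N by near: n.
    have n0 := ltnW n1.
    have d0 : 0 < ln (1 + e / 20) / 2 by rewrite divr_gt0 // ln_e20.
    have M0 := size_bound_gt0 (collXs n) (mu_gt0 _ n0) (XM n).
    have gn : `|g n| <= ln (1 + e / 20) / 2 * `|n%:R / M n|.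
      by near: n; apply: small; rewrite divr_gt0 // ln_e20.
    rewrite [leRHS](_ : e = 10 * (e / 20 + e / 20)); last by field.
    rewrite -mu_n -[in ln _](cardV n); apply: le_trans.
      apply: (prob_lt_pairwise_balanced (collXs n) (@balX n) (V_gt0 _ n0) (mu_gt0 _ n0) _
        (q2E n) _ (XM n) (ltW d0)); first by rewrite cardV.
      by rewrite cardV -[n%:R / M n]ger0_norm // divr_ge0 // ltW.
    rewrite [2 * _]mulrC divfK // expR_lnB1 ?e20 // ler_pM2l // lerD2l.
    apply: expRN_le; first exact: e20.
    by near: n; exact: w_oo.
  + move=> /eqoP small; apply: asymp => a /andP[a0 a1] e e0; near=> n.
    have n1 : (1 < n)%N by near: n.
    have n0 := ltnW n1.
    have ln0 : 0 < ln (n%:R : R) by rewrite ln_gt0 // ltr1n.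
    have d0 : 0 < ln (1 + e / 20) / 2 by rewrite divr_gt0 // ln_e20.
    have M0 := size_bound_gt0 (collXs n) (mu_gt0 _ n0) (XM n).
    have Mn : `|M n| <= ln (1 + e / 20) / 2 * `|n%:R / ln n%:R|.
      by near: n; apply: small; rewrite divr_gt0 // ln_e20.
    rewrite [leRHS](_ : e = 10 * (e / 20 + e / 20)); last by field.
    (* The first claim's bound is applied with [g = ln n] and [w = a ln n]. *)
    have -> : (1 - a) * ln n%:R = Num.min (ln n%:R) (ln n%:R - a * ln n%:R) :> R.
      rewrite min_r; first by ring.
      by rewrite lerBlDr lerDl mulr_ge0 // ltW.
    rewrite -mu_n -[X in ln X%:R - _](cardV n); apply: le_trans.
      apply: (prob_lt_pairwise_balanced (collXs n) (@balX n) (V_gt0 _ n0) (mu_gt0 _ n0) _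
        (q2E n) _ (XM n) (ltW d0)); first by rewrite cardV.
      (* The required [ln n <= delta n / M] is the bound [M <= delta n / ln n] with [M] and [ln n]
         exchanged. *)
      rewrite cardV (ger0_norm (ltW ln0)).
      move: Mn; rewrite (gtr0_norm M0) gtr0_norm ?divr_gt0 ?nR // !mulrA.
      by rewrite !ler_pdivlMr // mulrC.
    rewrite [2 * _]mulrC divfK // expR_lnB1 ?e20 // ler_pM2l // lerD2l.
    apply: expRN_le; first exact: e20.
    rewrite [leRHS]mulrC -ler_pdivrMr //.
    by near: n; exact: near_ln_ge.
Unshelve. all: by end_near. Qed.
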